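(* Let $K\ge1$, $0<r\le1$, $h>0$. For all $a,b,c>0$ there exist $\varrho=\varrho(a,b,c)>0$ and $\lambda_0=\lambda_0(a,b,c)\ge 1$ (depending only on $a,b,c$ and $K,r,h$) such that the following holds. Let $\mathfrak X\subset\mathbb R^2$ be an infinite set with $0\in\mathfrak X$, and let $X=(X_n,n\ge0)$ be an $\mathfrak X$-valued process adapted to a filtration $\mathcal F=(\mathcal F_n,n\ge0)$ which is a martingale, is uniformly elliptic with constants $h,r$, and has jumps uniformly bounded by $K$. Then $$\mathbb P_x\big[G^{a,b,c}_{v,\lambda}(x)\big]\ge\varrho$$ for all $\lambda\ge\lambda_0$, all $v\in\mathbb S^1$ and all $x\in\mathfrak X$.
   Context: $\|\cdot\|$ is the Euclidean norm, $\mathbb S^{1}$ the unit circle in $\mathbb R^2$, $x\cdot y$ the scalar product. The process is not assumed to be Markovian or homogeneous. $\mathbb P_x$ means that the initial state of the process is assumed to be $x$ (i.e. the inequality is asserted for processes as described with $X_0=x$ a.s.). Martingale: $\mathbb E(X_{n+1}-X_n\mid\mathcal F_n)=0$ a.s. for all $n$. Uniformly bounded jumps (constant $K$): $\|X_{n+1}-X_n\|\le K$ a.s. for all $n$. Uniformly elliptic (constants $h,r$): for all $n$ and all $\ell\in\mathbb S^{1}$, $\mathbb P[(X_{n+1}-X_n)\cdot\ell>r\mid\mathcal F_n]>h$ a.s. For a simply connected domain $\mathcal D\subset\mathbb R^2$ let $\tau(\mathcal D)=\min\{k\ge1:X_k\notin\mathcal D\}$ be the exit time, and let $$\mathcal S(\mathcal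 D)=\{\alpha X_{\tau(\mathcal D)-1}+(1-\alpha)X_{\tau(\mathcal D)}:\ 0\le\alpha\le1\}\subset\mathbb R^2$$ be the segment of the trajectory at the instant of leaving $\mathcal D$. For $v\in\mathbb S^1$, $a,b,c,\lambda>0$ and $x\in\mathbb R^2$, with $v^\bot$ a unit vector perpendicular to $v$, let $$R^{a,b,c}_{v,\lambda}(x)=\{y\in\mathbb R^2:\ |(y-x)\cdot v^\bot|<a\lambda,\ (y-x)\cdot v\in(-b\lambda,c\lambda)\}$$ and let $G^{a,b,c}_{v,\lambda}(x)$ be the event that the process leaves this rectangle through its ''left'' side: $$G^{a,b,c}_{v,\lambda}(x)=\Big\{\mathcal S\big(R^{a,b,c}_{v,\lambda}(x)\big)\cap\{y\in\mathbb R^2:\ |(y-x)\cdot v^\bot|\le a\lambda,\ (y-x)\cdot v=-b\lambda\}\ne\emptyset\Big\}.$$ *)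

(* Defs.v *)
From HB Require Import structures.
From mathcomp Require Import all_boot all_order all_algebra.
From mathcomp Require Import all_classical all_reals all_analysis.

Set Implicit Arguments.
Unset Strict Implicit.
Unset Printing Implicit Defensive.

Import Order.TTheory GRing.Theory Num.Theory.
Import numFieldNormedType.Exports.

Local Open Scope classical_set_scope.
Local Open Scope ring_scope.

(* The plane is R * R, with the product sigma-algebra of the library.  The
   library's norm on R * R is the sup norm, hence the Euclidean one below. *)
Definition dot (R : realType) (x y : R * R) : R := x.1 * y.1 + x.2 * y.2.

Definition enorm (R : realType) (x : R * R) : R := Num.sqrt (dot x x).

Definition unit_circle (R : realType) : set (R * R) := [set v | enorm v = 1].

Section conditional_expectation.
Context (R : realType) (d : measure_display) (Omega : measurableType d).
Variable P : probability Omega R.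

(* Z is a version of E(Y | G), for a sub-sigma-algebra G given by its set of
   members.  For such a G the measurable sets of g_sigma_algebraType G are
   exactly the members of G. *)
Definition is_cond_expect (G : set (set Omega)) (Y Z : Omega -> R) : Prop :=
  [/\ P.-integrable setT (EFin \o Y),
      P.-integrable setT (EFin \o Z),
      measurable_fun setT (Z : g_sigma_algebraType G -> R) &
      forall A, G A ->
        (\int[P]_(w in A) (Z w)%:E = \int[P]_(w in A) (Y w)%:E)%E].

Definition is_cond_expect2 (G : set (set Omega)) (Y Z : Omega -> R * R) : Prop :=
  is_cond_expect G (fun w => (Y w).1) (fun w => (Z w).1) /\
  is_cond_expect G (fun w => (Y w).2) (fun w => (Z w).2).

Definition is_cond_prob (G : set (set Omega)) (A : set Omega) (Z : Omega -> R)
  : Prop := is_cond_expect G \1_A Z.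

End conditional_expectation.

Section processes.
Context (R : realType) (d : measure_display) (Omega : measurableType d).
Variable P : probability Omega R.

Definition filtration (F : nat -> set (set Omega)) : Prop :=
  [/\ forall n, sigma_algebra setT (F n),
      forall n, F n `<=` measurable &
      forall m n, (m <= n)%N -> F m `<=` F n].

Variables (F : nat -> set (set Omega)) (X : nat -> Omega -> R * R).

Definition adapted : Prop :=
  forall n, measurable_fun setT (X n : g_sigma_algebraType (F n) -> R * R).

Definition jump (n : nat) (w : Omega) : R * R := X n.+1 w - X n w.

(* Versions of a conditional expectation agree almost surely, so a condition on
   E(. | F_n) that holds a.s. is stated for some version. *)
Definition is_martingale : Prop :=
  forall n, exists Z : Omega -> R * R,
    is_cond_expect2 P (F n) (jump n) Z /\ {ae P, forall w, Z w = 0}.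

Definition bounded_jumps (K : R) : Prop :=
  forall n, {ae P, forall w, enorm (jump n w) <= K}.

Definition uniformly_elliptic (h r : R) : Prop :=
  forall n (l : R * R), unit_circle l -> exists Z : Omega -> R,
    is_cond_prob P (F n) [set w | r < dot (jump n w) l] Z /\
    {ae P, forall w, h < Z w}.

Definition is_exit_time (D : set (R * R)) (w : Omega) (k : nat) : Prop :=
  [/\ (1 <= k)%N, ~ D (X k w) &
      forall j, (1 <= j)%N -> ~ D (X j w) -> (k <= j)%N].

(* Empty if the trajectory never leaves D. *)
Definition exit_segment (D : set (R * R)) (w : Omega) : set (R * R) :=
  [set y | exists k alpha, [/\ is_exit_time D w k, 0 <= alpha <= 1 &
     y = alpha *: X k.-1 w + (1 - alpha) *: X k w]].

End processes.

(* In the next definitions vp stands for the unit vector perpendicular to v. *)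
Definition rectangle (R : realType) (v vp : R * R) (a b c lambda : R)
    (x : R * R) : set (R * R) :=
  [set y | `|dot (y - x) vp| < a * lambda /\
           - (b * lambda) < dot (y - x) v < c * lambda].

Definition left_side (R : realType) (v vp : R * R) (a b lambda : R)
    (x : R * R) : set (R * R) :=
  [set y | `|dot (y - x) vp| <= a * lambda /\ dot (y - x) v = - (b * lambda)].

Definition left_exit (R : realType) (d : measure_display)
    (Omega : measurableType d) (X : nat -> Omega -> R * R) (v vp : R * R)
    (a b c lambda : R) (x : R * R) : set Omega :=
  [set w | exit_segment X (rectangle v vp a b c lambda x) w `&`
           left_side v vp a b lambda x !=set0].

(* Main.v *)
(** In the coordinates u = (X - x).v / lambda and w = (X - x).v^perp / lambda,
    put f(u, w) = exp (- alpha (u + m w^2)) with m = (c + 2b) / a^2.  The level set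
    {u + m w^2 < c} contains the starting point, and within one jump of the
    rectangle it can only be reached by crossing the left side, so
    f - exp (- alpha c) is nonpositive after every other exit.  As the gradient
    of u + m w^2 has norm at least 1, ellipticity makes the second-order term
    alpha^2 (grad . jump)^2 / 4 dominate for alpha large, and for lambda large
    the remainder of the expansion is negligible: f (X_n) is a strict
    submartingale inside the rectangle.  Strictness forces the exit time to be
    finite, and comparing f at time 0 and at the exit gives the lower bound
    (1 - exp (- alpha c)) / exp (2 alpha b).

    The gradient direction and the weight f (X_n) depend on X_n, whereas
    ellipticity and the martingale property only speak of deterministic
    directions and of sets of F_n.  The drift is therefore estimated on small
    F_n-measurable cells on which both are almost constant, and summed. *)
Require Import Defs.
From mathcomp Require Import all_boot all_order all_algebra.
From mathcomp Require Import all_classical all_reals all_analysis.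
From mathcomp Require Import measurable_realfun ring lra.
Import Order.TTheory GRing.Theory Num.Theory.
Import numFieldNormedType.Exports.
Local Open Scope classical_set_scope.
Local Open Scope ring_scope.

Set Implicit Arguments.
Unset Strict Implicit.

(** * Elementary bounds for the exponential barrier *)

(** This is the square of 1 + t/2 <= exp (t/2), whose left side is nonnegative for t >= -2. The
    coefficient 1/4 instead of 1/2 makes the bound hold for negative t without a cubic remainder. *)
Lemma quadratic_le_expR (R : realType) (t : R) :
  -2 <= t -> 1 + t + t ^+ 2 / 4 <= expR t.
Proof.
move=> t2; have -> : expR t = expR (t / 2) ^+ 2.
  by rewrite expr2 -expRD; congr expR; field.
have -> : 1 + t + t ^+ 2 / 4 = (1 + t / 2) ^+ 2 by field.
by rewrite ler_sqr ?nnegrE ?expR_ge1Dx ?expR_ge0//; lra.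
Qed.

Lemma ler_normM (R : realType) (x y X Y : R) :
  `|x| <= X -> `|y| <= Y -> `|x * y| <= X * Y.
Proof. by move=> ? ?; rewrite normrM ler_pM. Qed.

Definition barrier (R : realType) (alpha m u w : R) : R :=
  expR (- alpha * (u + m * w ^+ 2)).

(** [f0] and [w0] stand for the values of the barrier and of [w] at a fixed
    point of a cell: the lower bound then has deterministic coefficients. *)
Lemma barrier_increment (R : realType)
    (alpha m a delta e B u w p q f0 w0 : R) :
  0 < alpha -> 0 < m -> 0 <= a -> delta <= 1 ->
  alpha * (1 + 2 * m * a + m) * delta <= 2 ->
  `|p| <= delta -> `|q| <= delta -> `|w| <= a -> `|w0| <= a ->
  `|w - w0| <= e -> `|barrier alpha m u w - f0| <= e -> 0 <= f0 <= B ->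
  f0 * (- alpha * (p + 2 * m * w0 * q)
        + alpha ^+ 2 / 4 * (p + 2 * m * w0 * q) ^+ 2
        - alpha * m * delta ^+ 2
        - alpha ^+ 2 / 2 * (1 + 2 * m * a) * m * delta ^+ 3)
    - e * (3 + 4 * alpha * m * B)
  <= barrier alpha m (u + p) (w + q) - barrier alpha m u w.
Proof.
move=> al0 m0 a0 d1 small hp hq hw hw0 hww hff /andP[f00 f0B].
set f := barrier alpha m u w in hff *.
have d0 : 0 <= delta by apply: le_trans hp.
have e0 : 0 <= e by apply: le_trans hww.
(* [t w] is the exact increment of the exponent; [t w0] is its frozen version, with [w] replaced by
   [w0] in the coefficient of [q]. *)
pose t (z : R) := - alpha * (p + 2 * m * z * q + m * q ^+ 2).
have tbound z : `|z| <= a -> `|t z| <= 2.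
  move=> hz; have zq := ler_normM hz hq.
  have qq : q ^+ 2 <= delta.
    rewrite -real_normK ?num_real// expr2 (le_trans (ler_pM _ _ hq hq))//.
    by rewrite ler_piMl.
  have : `|p + 2 * m * z * q + m * q ^+ 2| <= (1 + 2 * m * a + m) * delta.
    have := sqr_ge0 q; move: hp zq.
    rewrite !ler_norml => /andP[? ?] /andP[? ?] ?.
    by apply/andP; split; nra.
  move=> /(ler_wpM2l (ltW al0)) h; rewrite /t mulNr normrN normrM gtr0_norm//.
  by apply: le_trans h _; rewrite mulrA.
have -> : barrier alpha m (u + p) (w + q) = f * expR (t w).
  by rewrite /f /barrier -expRD; congr expR; rewrite /t; ring.
have fpos : 0 < f by apply: expR_gt0.
have /quadratic_le_expR ht : -2 <= t w.
  by have := tbound _ hw; rewrite ler_norml => /andP[].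
have step1 : f * (t w + t w ^+ 2 / 4) <= f * expR (t w) - f.
  have -> : f * expR (t w) - f = f * (expR (t w) - 1) by ring.
  by rewrite ler_pM2l//; lra.
apply: le_trans step1.
have dt : `|t w - t w0| <= 2 * alpha * m * e.
  have -> : t w - t w0 = - (2 * alpha * m) * ((w - w0) * q) by rewrite /t; ring.
  have c0 : 0 < 2 * alpha * m by apply: mulr_gt0 => //; apply: mulr_gt0.
  rewrite normrM normrN (gtr0_norm c0).
  rewrite (ler_pM2l c0) -[leRHS]mulr1; apply: ler_normM => //.
  exact: le_trans hq d1.
have tw := tbound _ hw; have tw0 := tbound _ hw0.
(* Freezing error: replacing [f] by [f0] costs 3e, since |t + t^2/4| <= 3; replacing [t w] by [t w0]
   costs at most 2 alpha m e times the factor 2 bounding 1 + (t w + t w0)/4, times f0 <= B. *)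
have step2 : f0 * (t w0 + t w0 ^+ 2 / 4) - e * (3 + 4 * alpha * m * B)
    <= f * (t w + t w ^+ 2 / 4).
  have h1 : `|t w + t w ^+ 2 / 4| <= 3.
    move: tw; rewrite !ler_norml => /andP[? ?]; apply/andP; split; nra.
  have h2 : `|1 + (t w + t w0) / 4| <= 2.
    by move: tw tw0; rewrite !ler_norml => /andP[? ?] /andP[? ?];
      apply/andP; split; lra.
  have h3 := ler_normM hff h1.
  have h4 := ler_normM dt h2.
  have h5 : f0 * (2 * alpha * m * e * 2) <= B * (2 * alpha * m * e * 2).
    by rewrite ler_wpM2r// !mulr_ge0// ltW.
  have h6 : - ((2 * alpha * m * e * 2) * f0)
      <= ((t w - t w0) * (1 + (t w + t w0) / 4)) * f0.
    by rewrite -mulNr ler_wpM2r//; move: h4; rewrite ler_norml => /andP[].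
  move: h3; rewrite ler_norml => /andP[h3 _].
  have -> : f * (t w + t w ^+ 2 / 4) = f0 * (t w0 + t w0 ^+ 2 / 4)
    + (f - f0) * (t w + t w ^+ 2 / 4)
    + (t w - t w0) * (1 + (t w + t w0) / 4) * f0 by field.
  lra.
apply: le_trans step2; rewrite lerD2r ler_wpM2l//.
(* [L] is the differential of u + m w^2 at [w0], applied to the jump. In t + t^2/4 the terms in L
   and L^2 are kept, q^2 and L q^2 are bounded by powers of [delta], and the square of m q^2 is
   dropped. *)
set L := p + 2 * m * w0 * q.
have hL : `|L| <= (1 + 2 * m * a) * delta.
  have := ler_normM hw0 hq; move: hp; rewrite !ler_norml /L.
  by move=> /andP[? ?] /andP[? ?]; apply/andP; split; nra.
have hqq : q ^+ 2 <= delta ^+ 2.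
  by rewrite -[leLHS]real_normK ?num_real// ler_sqr ?nnegrE.
have hLq : `|L * q ^+ 2| <= (1 + 2 * m * a) * delta ^+ 3.
  have -> : delta ^+ 3 = delta * delta ^+ 2 by rewrite exprS.
  rewrite mulrA.
  by apply: ler_normM => //; rewrite ger0_norm ?sqr_ge0.
have -> : t w0 + t w0 ^+ 2 / 4 = - alpha * L + alpha ^+ 2 / 4 * L ^+ 2
    - alpha * m * q ^+ 2 + alpha ^+ 2 / 2 * m * (L * q ^+ 2)
    + alpha ^+ 2 / 4 * (m * q ^+ 2) ^+ 2 by rewrite /t /L; field.
have h7 : 0 <= alpha ^+ 2 / 4 * (m * q ^+ 2) ^+ 2.
  by apply: mulr_ge0; [apply: divr_ge0 => //|]; exact: sqr_ge0.
have h8 : alpha * m * q ^+ 2 <= alpha * m * delta ^+ 2.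
  by apply: ler_wpM2l => //; apply: mulr_ge0; exact: ltW.
have h9 : - (alpha ^+ 2 / 2 * (1 + 2 * m * a) * m * delta ^+ 3)
    <= alpha ^+ 2 / 2 * m * (L * q ^+ 2).
  have -> : - (alpha ^+ 2 / 2 * (1 + 2 * m * a) * m * delta ^+ 3) =
    alpha ^+ 2 / 2 * m * - ((1 + 2 * m * a) * delta ^+ 3) by ring.
  apply: ler_wpM2l.
    by apply: mulr_ge0; [apply: divr_ge0; rewrite ?sqr_ge0|exact: ltW].
  by move: hLq; rewrite ler_norml => /andP[].
lra.
Qed.

(** * Additive properties and slicing into cells *)

(** The range [-B, B] of [Y] is cut into finitely many intervals of length [e]; their preimages in
    [A] are disjoint cells on which [Y] varies by at most [e], and they are joined one at a time. *)
Lemma cell_induction (R : realType) (d : measure_display)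
    (T : measurableType d) (Q : set T -> Prop) (A : set T) (Y : T -> R)
    (B e : R) :
  measurable A -> measurable_fun setT Y -> 0 < e ->
  (forall w, A w -> `|Y w| <= B) ->
  Q set0 ->
  (forall C D, measurable C -> measurable D -> [disjoint C & D] ->
    C `|` D `<=` A -> Q C -> Q D -> Q (C `|` D)) ->
  (forall C, measurable C -> C `<=` A ->
    (forall w w', C w -> C w' -> `|Y w - Y w'| <= e) -> Q C) ->
  Q A.
Proof.
move=> mA mY e0 YB Q0 QU Qcell.
have mpre (I : interval R) : measurable (A `&` [set w | Y w \in I]).
  apply: measurableI => //; rewrite -[X in measurable X]setTI.
  exact: (mY measurableT [set` I] (measurable_itv _)).
pose L k := A `&` [set w | Y w \in `]-oo, - B + k%:R * e[%R].
have QL k : Q (L k).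
  elim: k => [|k IH].
    rewrite (_ : L 0%N = set0)//; apply/seteqP; split=> // w [/YB].
    by rewrite ler_norml /= in_itv /= => /andP[? _]; rewrite mul0r addr0; lra.
  have kS : k.+1%:R = k%:R + 1 :> R by rewrite natr1.
  pose D := A `&` [set w | Y w \in `[- B + k%:R * e, - B + k.+1%:R * e[%R].
  have -> : L k.+1 = L k `|` D.
    apply/seteqP; split=> w.
      move=> [Aw]; rewrite /= in_itv /= => Yw.
      by have [lt|ge] := ltP (Y w) (- B + k%:R * e); [left|right];
        split=> //=; rewrite in_itv /= ?ge.
    move=> [[Aw]|[Aw]]; rewrite /= !in_itv /= => Yw; split=> //=.
      by rewrite in_itv /= kS; lra.
    by rewrite in_itv /=; case/andP: Yw.
  have mL : measurable (L k) by exact: mpre.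
  have mD : measurable D by exact: mpre.
  apply: QU => //.
  - apply/disj_setPS => w [] [_ /=]; rewrite in_itv /= => lt [_ /=].
    by rewrite in_itv /= => /andP[ge _]; move: lt; rewrite ltNge ge.
  - by move=> w [[]|[]].
  - apply: Qcell => // [w []//|w w' [_ /=]].
    rewrite in_itv /= kS => /andP[? ?] [_ /=].
    rewrite in_itv /= kS => /andP[? ?].
    by rewrite ler_norml; apply/andP; split; lra.
(* Enough slices to pass the level [B]; the absolute value makes the Archimedean bound applicable
   whatever the sign of [B]. *)
pose k := Num.bound `|2 * B / e|.
have hk : 2 * B < k%:R * e.
  rewrite -ltr_pdivrMr//; apply: le_lt_trans (archi_boundP (normr_ge0 _)).
  exact: ler_norm.
suff -> : A = L k by [].
apply/seteqP; split=> [w Aw|w []//]; split=> //=.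
by rewrite in_itv /=; have := YB _ Aw; rewrite ler_norml => /andP[_ ?]; lra.
Qed.

(** * Null sets and conditional expectations *)

Section probability_facts.
Context (R : realType) (d : measure_display) (Omega : measurableType d).
Variable P : probability Omega R.

Lemma bounded_integrable (C : set Omega) (f : Omega -> R) (M : R) :
  measurable C -> measurable_fun setT f -> (forall w, C w -> `|f w| <= M) ->
  P.-integrable C (EFin \o f).
Proof.
move=> mC mf fM; apply: measurable_bounded_integrable => //.
- by rewrite (le_lt_trans (probability_le1 P mC))// ltry.
- exact: measurable_funTS.
- exists M; split; first exact: num_real.
  by move=> x Mx w Cw /=; apply: le_trans (fM _ Cw) (ltW Mx).
Qed.

Lemma Rintegral_setD_null (C N : set Omega) (f : Omega -> R) :
  measurable C -> measurable N -> P N = 0%E -> P.-integrable C (EFin \o f) ->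
  \int[P]_(w in C `\` N) f w = \int[P]_(w in C) f w.
Proof. by move=> mC mN N0 fi; rewrite /Rintegral -negligible_integral. Qed.

Lemma fine_setD_null (C N : set Omega) :
  measurable C -> measurable N -> P N = 0%E -> fine (P (C `\` N)) = fine (P C).
Proof.
move=> mC mN N0; rewrite -[RHS]mul1r -Rintegral_cst//.
rewrite -(@Rintegral_setD_null C N)//.
  by rewrite Rintegral_cst ?mul1r//; exact: measurableD.
apply: (@bounded_integrable _ _ 1) => // w _; by rewrite normr1.
Qed.

Lemma cond_expect_null (G : set (set Omega)) (Y Z : Omega -> R)
    (A : set Omega) :
  is_cond_expect P G Y Z -> {ae P, forall w, Z w = 0} -> G A -> measurable A ->
  \int[P]_(w in A) Y w = 0.
Proof.
move=> [Yi Zi _ YZ] Z0 GA mA; rewrite /Rintegral -YZ//.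
rewrite (@ae_eq_integral _ _ _ P A (cst 0%E))//.
- by rewrite integral0.
- move/integrableP : Zi => [mZ _]. exact: measurable_funS mZ.
- by apply: filterS Z0 => w Zw _ /=; rewrite Zw.
Qed.

(** Both sides are integrals over [A], of [h] and of the version [Z]; the null set where h < Z may
    fail is removed first. Ellipticity enters the drift estimate in this integrated form. *)
Lemma cond_prob_ge (G : set (set Omega)) (E A : set Omega) (Z : Omega -> R)
    (h : R) :
  0 < h -> is_cond_prob P G E Z -> {ae P, forall w, h < Z w} -> G A ->
  measurable A -> measurable E -> h * fine (P A) <= fine (P (E `&` A)).
Proof.
move=> h0 [_ Zi _ EZ] hZ GA mA mE.
have [N [mN N0 hN]] := hZ.
have Zi' : P.-integrable A (EFin \o Z) by exact: integrableS Zi.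
have -> : fine (P (E `&` A)) = \int[P]_(w in A) Z w.
  by rewrite /Rintegral EZ// integral_indic.
rewrite -(fine_setD_null mA mN N0) -Rintegral_cst; last exact: measurableD.
rewrite -(Rintegral_setD_null mA mN N0 Zi'); apply: le_Rintegral.
- exact: measurableD.
- by apply: (@bounded_integrable _ _ `|h|) => //; exact: measurableD.
- by apply: integrableS Zi' => //; exact: measurableD.
- by move=> w [_ Nw]; apply/ltW; apply: contrapT => Zw; exact/Nw/hN.
Qed.

End probability_facts.

Lemma measurable_bool_set (d : measure_display) (T : measurableType d)
    (g : T -> bool) :
  measurable_fun setT g -> measurable [set x | g x].
Proof.
move=> mg; rewrite -[X in measurable X]setTI.
exact: (mg measurableT [set true]).
Qed.

Lemma measurable_barrier (R : realType) (d : measure_display)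
    (T : measurableType d) (alpha m : R) (u w : T -> R) :
  measurable_fun setT u -> measurable_fun setT w ->
  measurable_fun setT (fun x => barrier alpha m (u x) (w x)).
Proof.
move=> mu mw; apply: measurableT_comp => //.
apply: measurable_funM => //; apply: measurable_funD => //.
by apply: measurable_funM => //; exact: measurable_funX.
Qed.

Lemma measurable_fun_sub_sigma (d : measure_display)
    (T : measurableType d) d' (U : measurableType d') (G : set (set T))
    (f : T -> U) :
  sigma_algebra setT G -> G `<=` measurable ->
  measurable_fun setT (f : g_sigma_algebraType G -> U) -> measurable_fun setT f.
Proof.
move=> sG Gm mf _ Y mY; apply: Gm; rewrite -(sigma_algebra_id sG).
exact: (mf measurableT Y mY).
Qed.

Lemma barrier_le (R : realType) (alpha m b u w : R) :
  0 < alpha -> 0 < m -> - b <= u -> barrier alpha m u w <= expR (alpha * b).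
Proof.
move=> al0 m0 ub; rewrite ler_expR mulNr -mulrN ler_pM2l// lerNl.
by apply: le_trans ub _; rewrite lerDl mulr_ge0 ?sqr_ge0// ltW.
Qed.

(** * Drift of the barrier *)

Section drift.
Context (R : realType) (d : measure_display) (Omega : measurableType d).
Variable P : probability Omega R.

(** The minorant of the barrier increment on a cell has this shape: two jump coordinates, an
    indicator and a constant. Zero coefficients give the cases of a scalar product and of a bound at
    the exit. *)
Lemma Rintegral_affine (D E : set Omega) (p q : Omega -> R)
    (x y z t : R) :
  measurable D -> measurable E ->
  P.-integrable D (EFin \o p) -> P.-integrable D (EFin \o q) ->
  \int[P]_(w in D) (x * p w + y * q w + z * \1_E w - t) =
  x * (\int[P]_(w in D) p w) + y * (\int[P]_(w in D) q w)
    + z * fine (P (E `&` D)) - t * fine (P D) /\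
  P.-integrable D (EFin \o (fun w => x * p w + y * q w + z * \1_E w - t)).
Proof.
move=> mD mE ip iq.
have i1 : P.-integrable D (EFin \o (\1_E : Omega -> R)).
  apply: (@bounded_integrable _ _ _ _ _ _ 1) => //.
  by move=> w _; rewrite indicE; case: (_ \in _); rewrite /= ?normr1 ?normr0.
have ic : P.-integrable D (EFin \o cst t).
  by apply: (@bounded_integrable _ _ _ _ _ _ `|t|).
have iZ k (f : Omega -> R) : P.-integrable D (EFin \o f) ->
    P.-integrable D (EFin \o (fun w => k * f w)).
  by move=> fi; rewrite (_ : _ \o _ = (fun w => k%:E * (EFin \o f) w)%E)//;
    exact: integrableZl.
have iD (f g : Omega -> R) : P.-integrable D (EFin \o f) ->
    P.-integrable D (EFin \o g) ->
    P.-integrable D (EFin \o (fun w => f w + g w)).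
  move=> fi gi.
  rewrite (_ : _ \o _ = ((EFin \o f) \+ (EFin \o g))%E)//.
  exact: integrableD.
have ipq := iD _ _ (iZ x _ ip) (iZ y _ iq).
have ipq1 := iD _ _ ipq (iZ z _ i1).
split; last first.
  by apply: iD => //; apply: (@bounded_integrable _ _ _ _ _ _ `|t|) => // w _;
    rewrite normrN.
rewrite RintegralB// RintegralD//; last exact: iZ.
rewrite RintegralD//; [|exact: iZ|exact: iZ].
rewrite !RintegralZl// Rintegral_cst//; congr (_ + _ * _ - _).
by rewrite /Rintegral integral_indic.
Qed.

(** On a cell in [G] where [w] and the barrier are almost constant, the increment has a minorant
    with deterministic coefficients. Integrated, its linear part vanishes by the martingale property
    and its square is at least s^2 on a proportion [h] of the cell. The gain [eta] is halved by the
    freezing error, and the cells are summed. *)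
Lemma barrier_drift (G : set (set Omega)) (N A : set Omega)
    (u w p q : Omega -> R) (alpha m a b c delta s h eta : R) :
  sigma_algebra setT G -> G `<=` measurable ->
  measurable N -> P N = 0%E ->
  measurable_fun setT (u : g_sigma_algebraType G -> R) ->
  measurable_fun setT (w : g_sigma_algebraType G -> R) ->
  P.-integrable setT (EFin \o p) -> P.-integrable setT (EFin \o q) ->
  (forall x, ~ N x -> `|p x| <= delta) ->
  (forall x, ~ N x -> `|q x| <= delta) ->
  (forall C, G C -> \int[P]_(x in C) p x = 0) ->
  (forall C, G C -> \int[P]_(x in C) q x = 0) ->
  (forall C k, G C -> `|k| <= 2 * m * a ->
    h * fine (P C) <= fine (P ([set x | s < p x + k * q x] `&` C))) ->
  0 < alpha -> 0 < m -> 0 <= a -> delta <= 1 -> 0 <= s -> 0 < eta ->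
  alpha * (1 + 2 * m * a + m) * delta <= 2 ->
  eta <= alpha ^+ 2 / 4 * s ^+ 2 * h - alpha * m * delta ^+ 2
         - alpha ^+ 2 / 2 * (1 + 2 * m * a) * m * delta ^+ 3 ->
  G A -> (forall x, A x -> `|w x| <= a /\ - b <= u x <= c) ->
  [/\ expR (- alpha * (c + m * a ^+ 2)) * eta / 2 * fine (P A) <=
    \int[P]_(x in A `\` N) barrier alpha m (u x + p x) (w x + q x)
    - \int[P]_(x in A `\` N) barrier alpha m (u x) (w x),
    P.-integrable (A `\` N)
      (fun x => (barrier alpha m (u x + p x) (w x + q x))%:E) &
    P.-integrable (A `\` N) (fun x => (barrier alpha m (u x) (w x))%:E)].
Proof.
move=> sG Gm mN N0 muG mwG ip iq hp hq Ep Eq ell al0 m0 a0 d1 s0 eta0 small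
  heta GA hA.
have mA : measurable A by exact: Gm.
have mu : measurable_fun setT u by exact: measurable_fun_sub_sigma muG.
have mw : measurable_fun setT w by exact: measurable_fun_sub_sigma mwG.
have mp : measurable_fun setT p by case/integrableP: ip => /measurable_EFinP.
have mq : measurable_fun setT q by case/integrableP: iq => /measurable_EFinP.
pose f x := barrier alpha m (u x) (w x).
pose f' x := barrier alpha m (u x + p x) (w x + q x).
have mf : measurable_fun setT f by exact: measurable_barrier.
have mf' : measurable_fun setT f'.
  by apply: measurable_barrier; exact: measurable_funD.
set fmin := expR (- alpha * (c + m * a ^+ 2)).
have fmin0 : 0 < fmin by exact: expR_gt0.
pose B := expR (alpha * b).
have fB x : A x -> fmin <= f x <= B.
  move=> /hA[wa /andP[ub uc]]; apply/andP; split; last exact: barrier_le.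
  rewrite ler_expR.
  rewrite mulNr lerNl mulNr opprK ler_pM2l// lerD// ler_pM2l//.
  by rewrite -[leLHS]real_normK ?num_real// ler_sqr ?nnegrE.
have fi C : measurable C -> C `<=` A -> P.-integrable C (EFin \o f).
  move=> mC CA; apply: (@bounded_integrable _ _ _ _ _ _ B) => // x /CA Ax.
  by rewrite ger0_norm ?expR_ge0//; case/andP: (fB x Ax).
have f'i C : measurable C -> C `<=` A `\` N -> P.-integrable C (EFin \o f').
  move=> mC CA.
  apply: (@bounded_integrable _ _ _ _ _ _ (expR (alpha * (b + 1)))).
  - by [].
  - by [].
  move=> x /CA [Ax Nx]; rewrite ger0_norm ?expR_ge0//; apply: barrier_le => //.
  have [_ /andP[ub _]] := hA x Ax; have := hp x Nx; rewrite ler_norml.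
  by move=> /andP[pd _]; lra.
have mAN : measurable (A `\` N) by exact: measurableD.
have iA' : P.-integrable (A `\` N) (EFin \o f) by apply: fi => // x [].
have iA'' : P.-integrable (A `\` N) (EFin \o f') by apply: f'i.
split => //; rewrite -RintegralB//.
pose Q C := C `<=` A ->
  fmin * eta / 2 * fine (P C) <= \int[P]_(x in C `\` N) (f' x - f x).
suff : Q A by apply.
have iQ C : measurable C -> C `<=` A ->
    P.-integrable (C `\` N) (EFin \o (fun x => f' x - f x)).
  move=> mC CA.
  rewrite (_ : _ \o _ = ((EFin \o f') \- (EFin \o f))%E)//.
  apply: integrableB; first exact: measurableD.
    by apply: f'i; [exact: measurableD|exact: setSD].
  by apply: fi; [exact: measurableD|move=> x [/CA]].
have Q0 : Q set0.
  by move=> _; rewrite set0D measure0 mulr0 Rintegral_set0.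
have GE : @measurable _ (g_sigma_algebraType G) = G by exact: sigma_algebra_id.
have QU C D : G C -> G D -> [disjoint C & D] -> C `|` D `<=` A ->
    Q C -> Q D -> Q (C `|` D).
  move=> /Gm mC /Gm mD CD CDA QC QD _.
  have {QC} QC : _ <= _ := QC (subset_trans (@subsetUl _ C D) CDA).
  have {QD} QD : _ <= _ := QD (subset_trans (@subsetUr _ C D) CDA).
  rewrite measureU//; last by apply/disj_set2P.
  rewrite fineD ?fin_num_measure// mulrDr; apply: le_trans (lerD QC QD) _.
  rewrite setDUl Rintegral_setU//; try exact: measurableD.
  - by rewrite -setDUl; apply: iQ => //; exact: measurableU.
  - apply/disj_set2P; move/disj_set2P : CD.
    rewrite -!subset0 => CD x [[? _] [? _]].
    exact: CD.
(* The mesh is chosen so that the freezing error equals half of the guaranteed gain fmin * eta. *)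
pose e := fmin * eta / (2 * (3 + 4 * alpha * m * B)).
have c20 : 0 < 3 + 4 * alpha * m * B.
  have B0 : 0 < B by exact: expR_gt0.
  by rewrite addr_gt0// !mulr_gt0.
have e0 : 0 < e by apply: divr_gt0; apply: mulr_gt0.
have eE : e * (3 + 4 * alpha * m * B) = fmin * eta / 2.
  by rewrite /e; field; rewrite gt_eqF.
(* Two nested slicings, by [w] and then by the barrier, both inside the sigma-algebra [G], so that
   every cell is a set to which [Ep], [Eq] and [ell] apply. *)
suff Qcell C : G C -> C `<=` A ->
    (forall x x', C x -> C x' -> `|w x - w x'| <= e) ->
    (forall x x', C x -> C x' -> `|f x - f x'| <= e) -> Q C.
  apply: (@cell_induction R _ (g_sigma_algebraType G) Q A w a e) => //.
  - by rewrite GE.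
  - by move=> x /hA[].
  - by rewrite GE.
  rewrite GE => C GC CA wC.
  apply: (@cell_induction R _ (g_sigma_algebraType G) Q C f B e) => //.
  - by rewrite GE.
  - exact: measurable_barrier.
  - by move=> x /CA /fB /andP[_ ?]; rewrite ger0_norm ?expR_ge0.
  - rewrite GE => C1 D1 ? ? ? CD; apply: QU => //.
    exact: subset_trans CD CA.
  - rewrite GE => D GD DC fD; apply: Qcell => //.
    + exact: subset_trans DC CA.
    + by move=> x x' /DC Cx /DC Cx'; exact: wC.
move=> GC CA wC fC _; have mC := Gm _ GC.
have [->|/set0P[x0 Cx0]] := eqVneq C set0; first exact: Q0.
have [w0a _] := hA _ (CA _ Cx0); have /andP[f0min f0B] := fB _ (CA _ Cx0).
(* The point [x0] of the cell fixes the slope [k] of the gradient direction and the weight [f0]. *)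
pose k := 2 * m * w x0; pose E := [set x | s < p x + k * q x].
have mE : measurable E.
  apply: measurable_bool_set; apply: measurable_fun_ltr => //.
  by apply: measurable_funD => //; exact: measurable_funM.
have ka : `|k| <= 2 * m * a.
  by rewrite /k normrM (gtr0_norm (_ : 0 < 2 * m)) ?ler_pM2l ?mulr_gt0.
pose f0 := f x0.
have f00 : 0 < f0 by exact: expR_gt0.
pose D := C `\` N; have mD : measurable D by exact: measurableD.
pose err := alpha * m * delta ^+ 2
  + alpha ^+ 2 / 2 * (1 + 2 * m * a) * m * delta ^+ 3.
pose z := f0 * (alpha ^+ 2 / 4 * s ^+ 2).
pose t := f0 * err + fmin * eta / 2.
have z0 : 0 <= z.
  by apply: mulr_ge0; [exact: ltW|rewrite mulr_ge0 ?divr_ge0 ?sqr_ge0].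
have ipD : P.-integrable D (EFin \o p) by exact: integrableS ip.
have iqD : P.-integrable D (EFin \o q) by exact: integrableS iq.
have [Eaff iaff] := @Rintegral_affine D E p q (- f0 * alpha) (- f0 * alpha * k)
  z t mD mE ipD iqD.
have pD : fine (P D) = fine (P C) by exact: fine_setD_null.
have pE : fine (P (E `&` D)) = fine (P (E `&` C)).
  by rewrite /D setIDA; apply: fine_setD_null => //; exact: measurableI.
have ipC : P.-integrable C (EFin \o p) by exact: integrableS ip.
have iqC : P.-integrable C (EFin \o q) by exact: integrableS iq.
have i0 : \int[P]_(x in D) p x = 0 by rewrite Rintegral_setD_null// Ep.
have j0 : \int[P]_(x in D) q x = 0 by rewrite Rintegral_setD_null// Eq.
(* The affine function in the middle minorizes the increment pointwise: the square of p + kq is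
   replaced by s^2 on [E] and by 0 elsewhere. *)
apply: (@le_trans _ _ (\int[P]_(x in D)
    (- f0 * alpha * p x + - f0 * alpha * k * q x + z * \1_E x - t))).
  rewrite Eaff i0 j0 !mulr0 !add0r pE pD.
  have hE : z * (h * fine (P C)) <= z * fine (P (E `&` C)).
    by apply: ler_wpM2l => //; exact: ell.
  have PC0 : 0 <= fine (P C) by exact: fine_ge0.
  apply: le_trans (lerB hE (lexx _)).
  rewrite mulrA -mulrBl; apply: ler_wpM2r => //.
  have -> : z * h - t = f0 * (alpha ^+ 2 / 4 * s ^+ 2 * h - err)
    - fmin * eta / 2 by rewrite /z /t; ring.
  have h1 : f0 * eta <= f0 * (alpha ^+ 2 / 4 * s ^+ 2 * h - err).
    by rewrite ler_pM2l// /err; lra.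
  have h2 : fmin * eta <= f0 * eta by rewrite ler_pM2r.
  lra.
apply: le_Rintegral => //; first exact: iQ.
move=> x [Cx Nx]; have [wa _] := hA _ (CA _ Cx).
have := @barrier_increment R alpha m a delta e B (u x) (w x) (p x) (q x) f0
  (w x0) al0 m0 a0 d1 small (hp _ Nx) (hq _ Nx) wa w0a (wC _ _ Cx Cx0)
  (fC _ _ Cx Cx0).
rewrite (ltW f00) f0B => /(_ isT) /(le_trans _); apply; rewrite eE.
rewrite -/k; have hs : s ^+ 2 * \1_E x <= (p x + k * q x) ^+ 2.
  rewrite indicE; have [|_] := boolP (x \in E); last by rewrite mulr0 sqr_ge0.
  rewrite inE /E /= mulr1 => sE.
  by rewrite ler_sqr ?nnegrE// ltW// (le_lt_trans s0 sE).
have h3 : z * \1_E x <= f0 * (alpha ^+ 2 / 4) * (p x + k * q x) ^+ 2.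
  rewrite /z [leLHS](_ : _ = f0 * (alpha ^+ 2 / 4) * (s ^+ 2 * \1_E x)).
    apply: ler_wpM2l => //; apply: mulr_ge0; first exact: ltW.
    by rewrite divr_ge0 ?sqr_ge0.
  by ring.
rewrite /t /err; lra.
Qed.
End drift.

(** * Geometry of the plane *)

Section plane.
Context (R : realType).
Implicit Types x y l v vp : R * R.

Lemma dot_unit l : unit_circle l -> dot l l = 1.
Proof.
move=> l1; have : enorm l ^+ 2 = 1 by rewrite l1 expr1n.
by rewrite sqr_sqrtr// /dot addr_ge0 ?sqr_ge0// -expr2 sqr_ge0.
Qed.

(** Cauchy-Schwarz, read off from Lagrange's identity in the plane. *)
Lemma normr_dot_le x l : unit_circle l -> `|dot x l| <= enorm x.
Proof.
move=> /dot_unit l1; rewrite -(sqrtr_sqr (dot x l)) ler_wsqrtr//.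
have -> : dot x x = dot x l ^+ 2 + (x.1 * l.2 - x.2 * l.1) ^+ 2.
  by rewrite -[LHS]mulr1 -l1 /dot; ring.
by rewrite lerDl sqr_ge0.
Qed.

(** Normalize v + k vp, whose length is g = sqrt (1 + k^2). Ellipticity concerns unit vectors, and g
    >= 1 ensures that passing to the gradient direction does not reduce the spread. *)
Lemma exists_direction v vp (k : R) :
  unit_circle v -> unit_circle vp -> dot v vp = 0 ->
  exists l g, [/\ unit_circle l, 1 <= g &
    forall y, dot y v + k * dot y vp = g * dot y l].
Proof.
move=> /dot_unit v1 /dot_unit vp1 vvp; pose g := Num.sqrt (1 + k ^+ 2).
have g2 : g ^+ 2 = 1 + k ^+ 2 by rewrite sqr_sqrtr// addr_ge0 ?sqr_ge0.
have g1 : 1 <= g by rewrite -[leLHS]sqrtr1 ler_wsqrtr// lerDl sqr_ge0.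
have g0 : g != 0 by rewrite gt_eqF// (lt_le_trans ltr01).
exists ((v.1 + k * vp.1) / g, (v.2 + k * vp.2) / g), g; split=> //.
- rewrite /unit_circle /= /enorm.
  rewrite (_ : dot _ _ = 1) ?sqrtr1//; rewrite /dot /=.
  have -> : (v.1 + k * vp.1) / g * ((v.1 + k * vp.1) / g)
      + (v.2 + k * vp.2) / g * ((v.2 + k * vp.2) / g)
    = (dot v v + 2 * k * dot v vp + k ^+ 2 * dot vp vp) / g ^+ 2.
    by rewrite /dot; field.
  by rewrite v1 vp1 vvp g2 mulr0 addr0 mulr1 divff// -g2 expf_neq0.
- by move=> y; rewrite /dot /=; field.
Qed.

Lemma dot_segment x y z l (t : R) :
  dot (t *: y + (1 - t) *: z - x) l =
  t * dot (y - x) l + (1 - t) * dot (z - x) l.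
Proof. by rewrite /dot /= /GRing.scale /=; ring. Qed.

Lemma conv_minmax (y z t : R) : 0 <= t -> t <= 1 ->
  Num.min y z <= t * y + (1 - t) * z <= Num.max y z.
Proof.
move=> t0 t1; have t1' : 0 <= 1 - t by rewrite subr_ge0.
have [|/ltW] := leP y z; rewrite -subr_ge0 => yz;
  have := mulr_ge0 t0 yz; have := mulr_ge0 t1' yz => h1 h2;
  by apply/andP; split; lra.
Qed.

Lemma divr_itv01 (y z : R) : 0 <= y -> y <= z -> 0 < z -> 0 <= y / z <= 1.
Proof.
by move=> y0 yz z0; rewrite (divr_ge0 y0 (ltW z0)) ler_pdivrMr// mul1r.
Qed.

(** The right-hand side is free of division and of quantifiers, which makes the
    measurability of [left_exit] immediate. *)
Lemma segment_hits_vertical (s s' t t' A beta : R) :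
  0 <= A ->
  (exists e, [/\ 0 <= e <= 1, e * s + (1 - e) * s' = beta &
     `|e * t + (1 - e) * t'| <= A]) <->
  (if s == s' then (s == beta) && ((Num.min t t' <= A) && (- A <= Num.max t t'))
   else (Num.min s s' <= beta) && (beta <= Num.max s s')
     && (`|(beta - s') * t + (s - beta) * t'| <= A * `|s - s'|)).
Proof.
move=> A0.
have [ss'|ss'] := eqVneq s s'.
  rewrite -ss'; split=> [[e [/andP[e0 e1]]]|/andP[/eqP <- /andP[]]].
    rewrite (_ : e * s + _ = s); last by ring.
    move=> ->; rewrite eqxx ler_norml /= => /andP[h1 h2].
    have /andP[h3 h4] := conv_minmax t t' e0 e1.
    by rewrite (le_trans h3 h2) (le_trans h1 h4).
  have e_s e : e * s + (1 - e) * s = s by ring.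
  (* Exchanging the endpoints replaces [e] by 1 - e. *)
  wlog : t t' / t <= t' => [hw|tt'].
    case/orP: (le_total t t') => tt'; first exact: hw.
    rewrite minC maxC => h1 h2; have [e [/andP[e0 e1] _ h]] := hw _ _ tt' h1 h2.
    exists (1 - e); split; [by apply/andP; split; lra|exact: e_s|].
    by rewrite (_ : _ + _ = e * t' + (1 - e) * t)//; ring.
  rewrite min_l// max_r// => tA At'.
  (* An endpoint in [-A, A] is taken if there is one; otherwise t < -A and A < t', and the point at
     height 0 is taken. *)
  have [h|h] := leP (- A) t.
    exists 1; split; [by rewrite ler01 lexx|exact: e_s|].
    by rewrite subrr mul0r addr0 mul1r ler_norml h tA.
  have [h'|h'] := leP t' A.
    exists 0; split; [by rewrite ler01 lexx|exact: e_s|].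
    by rewrite subr0 mul0r add0r mul1r ler_norml h' At'.
  have tt0 : 0 < t' - t by lra.
  exists (t' / (t' - t)); split; last 2 first.
  - exact: e_s.
  - rewrite (_ : _ + _ = 0) ?normr0//; field; exact: lt0r_neq0.
  by apply: divr_itv01; lra.
have ds : s - s' != 0 by rewrite subr_eq0.
have n0 : 0 < `|s - s'| by rewrite normr_gt0.
(* Multiplying by s - s' clears the denominator of the crossing parameter. *)
have key e : e * s + (1 - e) * s' = beta ->
    (e * t + (1 - e) * t') * (s - s') = (beta - s') * t + (s - beta) * t'.
  by move=> <-; ring.
split=> [[e [/andP[e0 e1] es eA]]|/andP[/andP[h1 h2] h3]].
  by rewrite -(key e es) normrM ler_pM2r// eA andbT -es conv_minmax.
pose e := (beta - s') / (s - s').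
have es : e * s + (1 - e) * s' = beta by rewrite /e; field.
exists e; split=> //; last by rewrite -(ler_pM2r n0) -normrM (key e es).
move: h1 h2; rewrite /e.
have [lt|lt|E] := ltgtP s s'; last by rewrite E eqxx in ss'.
  have d0 : 0 < s' - s by lra.
  have -> : (beta - s') / (s - s') = (s' - beta) / (s' - s).
    by field; rewrite ds lt0r_neq0.
  by move=> h1 h2; apply: divr_itv01; lra.
have d0 : 0 < s - s' by lra.
by move=> h1 h2; apply: divr_itv01; lra.
Qed.

End plane.

(** * Measurability of the exit event *)

Section measurability.
Context (R : realType) (d : measure_display) (T : measurableType d).

Lemma measurable_dot (Y : T -> R * R) (x l : R * R) :
  measurable_fun setT Y -> measurable_fun setT (fun w => dot (Y w - x) l).
Proof.
move=> mY; have m1 : measurable_fun setT (fun w => (Y w).1).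
  exact: (measurableT_comp measurable_fst mY).
have m2 : measurable_fun setT (fun w => (Y w).2).
  exact: (measurableT_comp measurable_snd mY).
by apply: measurable_funD; apply: measurable_funM => //; apply: measurable_funB.
Qed.

Lemma measurable_rectangle (Y : T -> R * R) (v vp x : R * R)
    (a b c lambda : R) :
  measurable_fun setT Y ->
  measurable [set w | rectangle v vp a b c lambda x (Y w)].
Proof.
move=> mY.
rewrite (_ : [set _ | _] = [set w | (`|dot (Y w - x) vp| < a * lambda) &&
   ((- (b * lambda) < dot (Y w - x) v) && (dot (Y w - x) v < c * lambda))]).
  apply: measurable_bool_set; apply: measurable_and.
    apply: measurable_fun_ltr => //.
    by apply: measurableT_comp => //; exact: measurable_dot.
  by apply: measurable_and; apply: measurable_fun_ltr => //;
    exact: measurable_dot.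
by apply/seteqP; split=> w => [[h1 h2]|/andP[h1 h2]]; [apply/andP|].
Qed.

(** Countable union over the exit time [k]. For fixed [k], exiting at [k] is a countable
    intersection of conditions on single positions, and the crossing condition becomes a boolean
    formula in measurable functions. *)
Lemma measurable_left_exit (X : nat -> T -> R * R) (v vp x : R * R)
    (a b c lambda : R) :
  0 <= a * lambda -> (forall n, measurable_fun setT (X n)) ->
  measurable (left_exit X v vp a b c lambda x).
Proof.
move=> al0 mX; set D := rectangle v vp a b c lambda x.
have mD n : measurable [set w | D (X n w)] by exact: measurable_rectangle.
pose s n w := dot (X n w - x) v; pose t n w := dot (X n w - x) vp.
pose H k := [set w | exists e, [/\ 0 <= e <= 1,
   e * s k.-1 w + (1 - e) * s k w = - (b * lambda) &
  `|e * t k.-1 w + (1 - e) * t k w| <= a * lambda]].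
have -> : left_exit X v vp a b c lambda x =
    \bigcup_k ([set w | is_exit_time X D w k] `&` H k).
  apply/seteqP; split => w.
    move=> [y [[k [e [Dk e01 ->]]] [/= h1 h2]]]; exists k => //; split=> //.
    by exists e; split=> //; rewrite /s /t -dot_segment.
  move=> [k _ [Dk [e [e01 h1 h2]]]].
  exists (e *: X k.-1 w + (1 - e) *: X k w); split; first by exists k, e.
  by split; rewrite dot_segment.
have ms n : measurable_fun setT (s n) by exact: measurable_dot.
have mt n : measurable_fun setT (t n) by exact: measurable_dot.
apply: bigcup_measurable => k _; apply: measurableI.
  rewrite (_ : [set _ | _] = [set w | (1 <= k)%N] `&` ~` [set w | D (X k w)] `&`
    \bigcap_j [set w | (1 <= j)%N -> ~ D (X j w) -> (k <= j)%N]); last first.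
    apply/seteqP; split=> w [].
      by move=> h1 h2 h; split=> // j _; exact: h.
    by move=> [h1 h2] h; split=> // j; exact: h.
  apply: measurableI; first apply: measurableI.
  - by case: (1 <= k)%N; [rewrite set_true|rewrite set_false].
  - exact: measurableC.
  apply: bigcap_measurable => // j _.
  have [kj|kj] := leqP k j.
    rewrite (_ : [set _ | _] = setT)//.
    by apply/seteqP; split=> // w _ /=.
  have [j1|j1] := leqP 1 j; last first.
    rewrite (_ : [set _ | _] = setT)//.
    by apply/seteqP; split=> // w _ /=.
  rewrite (_ : [set _ | _] = [set w | D (X j w)])//.
  apply/seteqP; split=> w /= => [h|Dj _ /(_ Dj)//].
  by apply: contrapT => /(h isT).
rewrite (_ : H k = [set w | if s k.-1 w == s k w
    then (s k.-1 w == - (b * lambda)) &&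
      ((Num.min (t k.-1 w) (t k w) <= a * lambda) &&
       (- (a * lambda) <= Num.max (t k.-1 w) (t k w)))
   else (Num.min (s k.-1 w) (s k w) <= - (b * lambda)) &&
     (- (b * lambda) <= Num.max (s k.-1 w) (s k w))
     && (`|(- (b * lambda) - s k w) * t k.-1 w
           + (s k.-1 w - - (b * lambda)) * t k w|
         <= a * lambda * `|s k.-1 w - s k w|)]); last first.
  by apply/seteqP; split=> w /(segment_hits_vertical _ _ _ _ _ al0).
apply: measurable_bool_set; apply: measurable_fun_ifT.
- exact: measurable_fun_eqr.
- apply: measurable_and; first exact: measurable_fun_eqr.
  apply: measurable_and; apply: measurable_fun_ler => //.
    exact: measurable_minr.
  exact: measurable_maxr.
- apply: measurable_and; first apply: measurable_and.
  + by apply: measurable_fun_ler => //; exact: measurable_minr.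
  + by apply: measurable_fun_ler => //; exact: measurable_maxr.
  + apply: measurable_fun_ler.
      apply: measurableT_comp => //; apply: measurable_funD;
        apply: measurable_funM => //; exact: measurable_funB.
    apply: measurable_funM => //; apply: measurableT_comp => //.
    exact: measurable_funB.
Qed.

End measurability.

Lemma dotZr (R : realType) (t : R) (y l : R * R) : dot y (t *: l) = t * dot y l.
Proof. by rewrite /dot /= /GRing.scale /=; ring. Qed.

Lemma dot_jump (R : realType) (d : measure_display)
    (T : measurableType d) (X : nat -> T -> R * R) (n : nat) (w : T)
    (x l : R * R) :
  dot (X n.+1 w - x) l = dot (X n w - x) l + dot (jump X n w) l.
Proof. by rewrite /dot /jump /=; ring. Qed.

(** Scaling the directions instead of the points keeps the normalized coordinates linear, so that
    their increments are scalar products with the jumps. *)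
Lemma rectangle_scaled (R : realType) (v vp x y : R * R) (a b c lambda : R) :
  0 < lambda ->
  rectangle v vp a b c lambda x y <->
  `|dot (y - x) (lambda^-1 *: vp)| < a /\
  - b < dot (y - x) (lambda^-1 *: v) < c.
Proof.
move=> l0; rewrite !dotZr normrM (gtr0_norm (_ : 0 < lambda^-1)) ?invr_gt0//.
by rewrite !(mulrC lambda^-1) ltr_pdivrMr// ltr_pdivlMr// ltr_pdivrMr// mulNr.
Qed.

(** * Jumps of the process *)

Section jumps.
Context (R : realType) (d : measure_display) (Omega : measurableType d).
Variables (P : probability Omega R) (F : nat -> set (set Omega))
  (X : nat -> Omega -> R * R).

Lemma jump_mean0 (n : nat) (l : R * R) :
  filtration F -> is_martingale P F X ->
  P.-integrable setT (EFin \o (fun w => dot (jump X n w) l)) /\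
  forall C, F n C -> \int[P]_(w in C) dot (jump X n w) l = 0.
Proof.
move=> [_ Fm _] /(_ n)[Z [[Z1 Z2] Z0]].
have Z10 : {ae P, forall w, (Z w).1 = 0} by apply: filterS Z0 => w ->.
have Z20 : {ae P, forall w, (Z w).2 = 0} by apply: filterS Z0 => w ->.
have i1 : P.-integrable setT (EFin \o (fun w => (jump X n w).1)) by case: Z1.
have i2 : P.-integrable setT (EFin \o (fun w => (jump X n w).2)) by case: Z2.
have dotE : (fun w => dot (jump X n w) l) = (fun w =>
    l.1 * (jump X n w).1 + l.2 * (jump X n w).2 + 0 * \1_set0 w - 0).
  by apply/funext => w; rewrite /dot; ring.
rewrite dotE; split=> [|C FC].
  by case: (@Rintegral_affine _ _ _ P setT set0 _ _ l.1 l.2 0 0 _ _ i1 i2).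
have mC := Fm _ _ FC.
have [-> _] := @Rintegral_affine _ _ _ P C set0 _ _ l.1 l.2 0 0 mC measurable0
  (integrableS measurableT mC (@subsetT _ C) i1)
  (integrableS measurableT mC (@subsetT _ C) i2).
rewrite (cond_expect_null Z1 Z10 FC mC) (cond_expect_null Z2 Z20 FC mC).
by rewrite !mulr0 !mul0r !addr0 subr0.
Qed.

(** With v + k vp = g l, [l] a unit vector and g >= 1, a jump exceeding [r] along [l] exceeds r /
    lambda in the scaled combination. *)
Lemma jump_spread (n : nat) (v vp : R * R) (h r lambda k : R) (C : set Omega) :
  filtration F -> adapted F X -> uniformly_elliptic P F X h r ->
  0 < h -> 0 <= r -> 0 < lambda ->
  unit_circle v -> unit_circle vp -> dot v vp = 0 -> F n C ->
  h * fine (P C) <=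
  fine (P ([set w | r / lambda < dot (jump X n w) (lambda^-1 *: v)
    + k * dot (jump X n w) (lambda^-1 *: vp)] `&` C)).
Proof.
move=> [Fs Fm Fi] aX ell h0 r0 l0 uv uvp vvp FC.
have [l [g [ul g1 gE]]] := @exists_direction R v vp k uv uvp vvp.
have [Z [EZ hZ]] := ell n l ul.
have mX j : measurable_fun setT (X j).
  exact: (measurable_fun_sub_sigma (Fs j) (Fm j) (aX j)).
have mj y : measurable_fun setT (fun w => dot (jump X n w) y).
  rewrite (_ : (fun w => _) =
      (fun w => dot (X n.+1 w - 0) y - dot (X n w - 0) y)).
    by apply: measurable_funB; exact: measurable_dot.
  by apply/funext => w; rewrite dot_jump; ring.
have mC := Fm _ _ FC.
have m1 : measurable [set w | r < dot (jump X n w) l].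
  by apply: measurable_bool_set; exact: measurable_fun_ltr.
have m2 : measurable [set w | r / lambda < dot (jump X n w) (lambda^-1 *: v)
    + k * dot (jump X n w) (lambda^-1 *: vp)].
  apply: measurable_bool_set; apply: measurable_fun_ltr => //.
  by apply: measurable_funD => //; exact: measurable_funM.
apply: le_trans (cond_prob_ge h0 EZ hZ FC mC m1) _.
rewrite fine_le ?fin_num_measure//; try exact: measurableI.
apply: le_measure; rewrite ?inE; try exact: measurableI.
apply: setSI => w /= rl.
rewrite !dotZr mulrCA -mulrDr gE mulrC ltr_pM2l ?invr_gt0//.
apply: (lt_le_trans rl); rewrite ler_peMl// ltW// (le_lt_trans r0 rl)//.
Qed.

End jumps.

(** * From the drift to the exit probability *)

(** Since [phi] stays bounded, the increments [kappa * pr n] force [pr n] to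
    become small, so the term [B * pr n] drops out. *)
Lemma potential_bound (R : realType) (phi pr : nat -> R) (kappa B ell c0 : R) :
  0 < kappa -> (forall n, phi n + kappa * pr n <= phi n.+1) ->
  (forall n, pr n.+1 <= pr n) -> (forall n, 0 <= pr n) ->
  (forall n, phi n <= B * pr n + ell) ->
  c0 <= phi 0%N -> c0 <= ell.
Proof.
move=> k0 step dec pr0 up c0phi.
(* As [pr] decreases, each of the first [n] increments is at least kappa * pr n. *)
have low n : c0 + kappa * (n%:R * pr n) <= phi n.
  elim: n => [|n IH]; first by rewrite mul0r mulr0 addr0.
  apply: le_trans (step n); apply: le_trans (lerD IH (lexx _)).
  rewrite -addrA lerD2l -mulrDr ler_pM2l// -natr1 mulrDl mul1r.
  by apply: lerD => //; apply: ler_wpM2l.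
pose n := Num.bound `|B / kappa|.
have hn : B <= kappa * n%:R.
  rewrite mulrC -ler_pdivrMr//; apply: le_trans (ler_norm _) _.
  exact: ltW (archi_boundP (normr_ge0 _)).
have := le_trans (low n) (up n); have := ler_wpM2r (pr0 n) hn.
by rewrite -mulrA => h1 h2; lra.
Qed.

(** The jump bound gives u1 > -2b, so m w1^2 < c + 2b = m a^2 and |w1| < a; this is what fixes [m].
    Also u1 < c, so only u1 <= -b is left outside the rectangle, and the last segment meets u = -b
    at a height between w0 and w1. *)
Lemma left_exit_crossing (R : realType) (d : measure_display)
    (Omega : measurableType d) (X : nat -> Omega -> R * R) (n : nat)
    (w : Omega) (v vp x : R * R) (a b c lambda : R) :
  0 < a -> 0 < b -> 0 < lambda ->
  (forall j, (j <= n)%N -> rectangle v vp a b c lambda x (X j w)) ->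
  ~ rectangle v vp a b c lambda x (X n.+1 w) ->
  `|dot (jump X n w) (lambda^-1 *: v)| <= b ->
  dot (X n.+1 w - x) (lambda^-1 *: v)
    + (c + 2 * b) / a ^+ 2 * dot (X n.+1 w - x) (lambda^-1 *: vp) ^+ 2 < c ->
  left_exit X v vp a b c lambda x w.
Proof.
move=> a0 b0 l0 inD outD jb sub.
have /(rectangle_scaled _ _ _ _ _ _ _ l0)[] := inD n (leqnn n).
move: jb sub; have := @dot_jump R _ _ X n w x (lambda^-1 *: v).
set u0 := dot (X n w - x) _; set w0 := dot (X n w - x) (_ *: vp).
set u1 := dot (X n.+1 w - x) _; set w1 := dot (X n.+1 w - x) (_ *: vp).
move=> u1E; rewrite ler_norml => /andP[jb _] sub w0a /andP[u0b u0c].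
have u1b : - (2 * b) < u1 by lra.
have a20 : 0 < a ^+ 2 by rewrite exprn_gt0.
have w1a : `|w1| < a.
  rewrite -ltr_sqr ?nnegrE ?(ltW a0)// real_normK ?num_real//.
  have h1 : (c + 2 * b) / a ^+ 2 * w1 ^+ 2 < c + 2 * b by lra.
  have c2b : 0 < c + 2 * b by lra.
  by move: h1; rewrite mulrAC ltr_pdivrMr// ltr_pM2l.
have u1c : u1 < c.
  apply: le_lt_trans sub; rewrite lerDl mulr_ge0 ?sqr_ge0// divr_ge0 ?ltW//.
  by lra.
have u1_b : u1 <= - b.
  rewrite leNgt; apply/negP => bu; apply: outD.
  by apply/rectangle_scaled => //; split=> //; apply/andP.
(* Solution of e u0 + (1 - e) u1 = -b. *)
pose e := (- b - u1) / (u0 - u1).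
have e01 : 0 <= e <= 1 by apply: divr_itv01; lra.
exists (e *: X n w + (1 - e) *: X n.+1 w); split.
  exists n.+1, e; split=> //; split=> // j j1 jD.
  by rewrite ltnNge; apply/negP => /inD.
have scale y l : dot (y - x) l = lambda * dot (y - x) (lambda^-1 *: l).
  by rewrite dotZr mulrA divff ?mul1r// gt_eqF.
split; rewrite scale dot_segment -/u0 -/u1 -/w0 -/w1.
  rewrite normrM gtr0_norm// mulrC ler_pM2r//.
  have /andP[e0 e1] := e01; have /andP[h1 h2] := conv_minmax w0 w1 e0 e1.
  rewrite ler_norml; apply/andP; split.
    by apply: le_trans h1; rewrite le_min !ltW//;
      [move: w1a|move: w0a]; rewrite ltr_norml => /andP[].
  by apply: le_trans h2 _; rewrite ge_max !ltW//;
    [move: w1a|move: w0a]; rewrite ltr_norml => /andP[].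
rewrite (_ : e * u0 + _ = - b) ?mulrN 1?mulrC// /e; field.
by rewrite gt_eqF//; lra.
Qed.

Lemma left_exit_prob (R : realType) (K r h a b c alpha lambda eta : R)
    (v vp x : R * R) (d : measure_display) (Omega : measurableType d)
    (P : probability Omega R) (F : nat -> set (set Omega))
    (X : nat -> Omega -> R * R) :
  let m := (c + 2 * b) / a ^+ 2 in
  let delta := K / lambda in
  0 <= r -> 0 < h -> 0 < a -> 0 < b -> 0 < c -> 0 < alpha -> 0 < lambda ->
  0 < eta -> delta <= 1 -> delta <= b ->
  alpha * (1 + 2 * m * a + m) * delta <= 2 ->
  eta <= alpha ^+ 2 / 4 * (r / lambda) ^+ 2 * h - alpha * m * delta ^+ 2
         - alpha ^+ 2 / 2 * (1 + 2 * m * a) * m * delta ^+ 3 ->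
  unit_circle v -> unit_circle vp -> dot v vp = 0 ->
  filtration F -> adapted F X -> is_martingale P F X ->
  uniformly_elliptic P F X h r -> bounded_jumps P X K ->
  {ae P, forall w, X 0%N w = x} ->
  1 - expR (- alpha * c) <=
    expR (alpha * (2 * b)) * fine (P (left_exit X v vp a b c lambda x)).
Proof.
move=> m delta r0 h0 a0 b0 c0 al0 l0 eta0 d1 db small heta uv uvp vvp hF aX
  martX ellX jX X0.
have [Fs Fm Fi] := hF.
have c2b : 0 < c + 2 * b by lra.
have m0 : 0 < m by rewrite divr_gt0// exprn_gt0.
(* [theta] is the barrier on the level set u + m z^2 = c; [B] bounds it for u >= -2b, hence up to
   one jump beyond the left side. *)
set theta := expR (- alpha * c); set B := expR (alpha * (2 * b)).
have theta0 : 0 < theta by exact: expR_gt0.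
have B0 : 0 < B by exact: expR_gt0.
set L := left_exit X v vp a b c lambda x.
set D := rectangle v vp a b c lambda x.
pose u n w := dot (X n w - x) (lambda^-1 *: v).
pose z n w := dot (X n w - x) (lambda^-1 *: vp).
pose p n w := dot (jump X n w) (lambda^-1 *: v).
pose q n w := dot (jump X n w) (lambda^-1 *: vp).
pose f n w := barrier alpha m (u n w) (z n w).
have mX n : measurable_fun setT (X n).
  exact: (measurable_fun_sub_sigma (Fs n) (Fm n) (aX n)).
have mL : measurable L.
  by apply: measurable_left_exit => //; rewrite mulr_ge0 ?ltW.
(* A single null set serves the initial state and all the jumps. *)
have [N [mN N0 hN]] : {ae P, forall w, X 0%N w = x /\
    forall n, enorm (jump X n w) <= K}.
  by apply: filterS2 X0 (ae_foralln jX) => w.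
have goodX w : ~ N w -> X 0%N w = x /\ forall n, enorm (jump X n w) <= K.
  by move=> Nw; apply: contrapT => /hN.
have jumpl y n w : unit_circle y -> ~ N w ->
    `|dot (jump X n w) (lambda^-1 *: y)| <= delta.
  move=> uy /goodX[_ /(_ n) jn].
  rewrite dotZr normrM gtr0_norm ?invr_gt0// mulrC ler_pM2r ?invr_gt0//.
  exact: le_trans (normr_dot_le _ uy) jn.
pose A n := [set w | forall j, (j <= n)%N -> D (X j w)].
have AS n : A n.+1 = A n `&` [set w | D (X n.+1 w)].
  apply/seteqP; split=> w.
    by move=> h1; split=> [j jn|]; apply: h1 => //; exact: leqW.
  by move=> [h1 h2] j; rewrite leq_eqVlt => /orP[/eqP ->|/h1].
have A0E : A 0%N = [set w | D (X 0%N w)].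
  by apply/seteqP; split=> w h1; [exact: h1|move=> j; rewrite leqn0 => /eqP ->].
have FD n : F n [set w | D (X n w)].
  rewrite -[F n](sigma_algebra_id (Fs n)).
  exact: (@measurable_rectangle _ _ (g_sigma_algebraType (F n)) (X n)).
have FA n : F n (A n).
  elim: n => [|n IH]; first by rewrite A0E; exact: FD.
  rewrite AS -[F n.+1](sigma_algebra_id (Fs _)).
  apply: (@measurableI _ (g_sigma_algebraType (F n.+1)));
    rewrite /measurable /= sigma_algebra_id//.
  exact: Fi IH.
have mA n : measurable (A n) by exact: Fm (FA n).
have A_in n w : A n w -> `|z n w| <= a /\ - b <= u n w <= c.
  move=> /(_ n (leqnn n))/(rectangle_scaled _ _ _ _ _ _ _ l0)[z1 /andP[u1 u2]].
  by split; [exact: ltW|rewrite !ltW].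
have [kappa [kappa0 drift]] : exists kappa, 0 < kappa /\ forall n,
    [/\ kappa * fine (P (A n)) <=
      \int[P]_(w in A n `\` N) f n.+1 w - \int[P]_(w in A n `\` N) f n w,
      P.-integrable (A n `\` N) (EFin \o f n.+1) &
      P.-integrable (A n `\` N) (EFin \o f n)].
  exists (expR (- alpha * (c + m * a ^+ 2)) * eta / 2); split.
    by rewrite divr_gt0// mulr_gt0// expR_gt0.
  move=> n.
  have fE : f n.+1 = fun w => barrier alpha m (u n w + p n w) (z n w + q n w).
    by apply/funext => w; rewrite /f /u /z !(dot_jump X n w x).
  have [ip Ep] := jump_mean0 n (lambda^-1 *: v) hF martX.
  have [iq Eq] := jump_mean0 n (lambda^-1 *: vp) hF martX.
  rewrite fE; apply: (@barrier_drift _ _ _ P (F n) N (A n) (u n) (z n) (p n)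
    (q n) alpha m a b c delta (r / lambda) h eta) => //.
  - exact: (@measurable_dot _ _ (g_sigma_algebraType (F n))).
  - exact: (@measurable_dot _ _ (g_sigma_algebraType (F n))).
  - by move=> w Nw; exact: jumpl.
  - by move=> w Nw; exact: jumpl.
  - by move=> C k FC _; exact: (jump_spread _ hF aX ellX).
  - exact: ltW.
  - by rewrite divr_ge0// ltW.
  - exact: A_in.
pose pr n := fine (P (A n)).
pose I n := \int[P]_(w in A n `\` N) f n w.
(* [phi] is the mean of [f - theta] on the paths still inside at time [n], plus
   [B] times the probability of having left through the left side. *)
pose phi n := I n - theta * pr n + B * fine (P (L `\` A n)).
have pr0 n : 0 <= pr n by exact: fine_ge0.
have finP (E : set Omega) : measurable E -> P E \is a fin_num.
  by move=> mE; exact: fin_num_measure.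
have PSub (E E' : set Omega) : measurable E -> measurable E' -> E `<=` E' ->
    fine (P E) <= fine (P E').
  by move=> mE mE' EE; rewrite fine_le ?finP//; apply: le_measure; rewrite ?inE.
have PU (E E' : set Omega) : measurable E -> measurable E' ->
    [disjoint E & E'] -> fine (P (E `|` E')) = fine (P E) + fine (P E').
  move=> mE mE' EE; rewrite measureU//; last exact/disj_set2P.
  by rewrite fineD ?finP.
apply: (@potential_bound _ phi pr kappa B) => //.
- move=> n; have [dr i1 i0] := drift n.
  (* The event of leaving exactly at time n + 1. *)
  pose Ex := A n `\` A n.+1.
  have mEx : measurable Ex by exact: measurableD.
  have AE : A n = A n.+1 `|` Ex.
    by rewrite /Ex setDUK// AS; exact: subIsetl.
  have AEd : [disjoint A n.+1 & Ex] by apply/disj_setPS => w [? []].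
  have prE : pr n = pr n.+1 + fine (P Ex) by rewrite /pr AE PU// -AE.
  have LE : L `\` A n.+1 = (L `\` A n) `|` (L `&` Ex).
    apply/seteqP; split=> w.
      by move=> [Lw Aw]; have [?|?] := pselect (A n w); [right|left].
    move=> [[Lw Aw]|[Lw [? ?]]]; split=> //; move: Aw.
    by rewrite AE => Aw ?; apply: Aw; left.
  have ->: phi n.+1 = I n.+1 - theta * pr n.+1 + B * fine (P (L `\` A n))
      + B * fine (P (L `&` Ex)).
    rewrite /phi LE PU ?mulrDr ?addrA//;
      [exact: measurableD|exact: measurableI|].
    by apply/disj_setPS => w [[? ?] [? []]].
  have mAN k : measurable (A k `\` N) by exact: measurableD.
  have mEN : measurable (Ex `\` N) by exact: measurableD.
  have split_int : \int[P]_(w in A n `\` N) f n.+1 w =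
      I n.+1 + \int[P]_(w in Ex `\` N) f n.+1 w.
    rewrite [in LHS]AE setDUl Rintegral_setU//.
      by rewrite -setDUl -AE.
    by apply/disj_setPS => w [[? _] [[] ]].
  have exit_int : \int[P]_(w in Ex `\` N) f n.+1 w <=
      theta * fine (P Ex) + B * fine (P (L `&` Ex)).
    have i_f : P.-integrable (Ex `\` N) (EFin \o f n.+1).
      by apply: integrableS i1 => // w [[? _] ?].
    have icst k : P.-integrable (Ex `\` N) (EFin \o (fun=> k : R)).
      by apply: (@bounded_integrable _ _ _ _ _ _ `|k|).
    have [E1 i2] := @Rintegral_affine _ _ _ P (Ex `\` N) L (fun=> 0) (fun=> 0)
      0 0 B (- theta) mEN mL (icst 0) (icst 0).
    have PEN : fine (P (Ex `\` N)) = fine (P Ex) by exact: fine_setD_null.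
    have PLEN : fine (P (L `&` (Ex `\` N))) = fine (P (L `&` Ex)).
      by rewrite setIDA; apply: fine_setD_null => //; exact: measurableI.
    apply: (@le_trans _ _ (\int[P]_(w in Ex `\` N)
        (0 * 0 + 0 * 0 + B * \1_L w - - theta))); last first.
      by rewrite E1 PEN PLEN !mul0r !add0r mulNr opprK addrC.
    apply: le_Rintegral => // w [[Anw Aw] Nw].
    rewrite !mul0r !add0r opprK.
    have outD : ~ D (X n.+1 w) by move=> Dw; apply: Aw; rewrite AS.
    have jb := le_trans (jumpl _ n w uv Nw) db.
    (* Either the exit point lies outside the sublevel set and the barrier is at most [theta], or
       the left side was crossed and it is at most [B]. *)
    have [sub|sub] := ltP (u n.+1 w + m * z n.+1 w ^+ 2) c; last first.
      have ft : f n.+1 w <= theta by rewrite ler_expR !mulNr lerN2 ler_pM2l.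
      apply: le_trans ft _; rewrite lerDr; apply: mulr_ge0; first exact: ltW.
      by rewrite indicE; case: (_ \in _).
    have Lw : L w by exact: left_exit_crossing Anw outD jb sub.
    rewrite indicE mem_set// mulr1.
    apply: ler_wpDr; [exact: ltW|apply: barrier_le] => //.
    have [_ /andP[ub _]] := A_in n w Anw.
    rewrite /u (dot_jump X n w x) -/(u n w).
    move: jb; rewrite ler_norml => /andP[? _].
    by lra.
  rewrite split_int in dr; rewrite /phi -/(I n) prE.
  by rewrite -/(I n) -/(pr n) prE in dr; lra.
- by move=> n; apply: PSub => //; rewrite AS; exact: subIsetl.
- move=> n; have [_ _ i0] := drift n.
  have I_le : I n <= B * pr n.
    rewrite /pr -(fine_setD_null (mA n) mN N0) -Rintegral_cst;
      last exact: measurableD.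
    apply: le_Rintegral => //; first exact: measurableD.
      apply: (@bounded_integrable _ _ _ _ _ _ `|B|) => //; exact: measurableD.
    move=> w [/A_in[_ /andP[ub _]] _]; apply: barrier_le => //; lra.
  have PL : B * fine (P (L `\` A n)) <= B * fine (P L).
    rewrite ler_pM2l//; apply: PSub => //; exact: measurableD.
  have := mulr_ge0 (ltW theta0) (pr0 n); rewrite /phi; lra.
- have [_ _ i0] := drift 0%N.
  (* Off [N] the process starts at [x], inside the rectangle, where the barrier is 1; hence phi 0 >=
     1 - theta. *)
  have AN : A 0%N `\` N = setT `\` N.
    apply/seteqP; split=> w [_ Nw]; split=> //; rewrite A0E /=.
    have [-> _] := goodX w Nw; apply/rectangle_scaled => //.
    rewrite /dot /= !subrr !mul0r addr0 normr0; split=> //.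
    by apply/andP; split; lra.
  have pr1 : pr 0%N = 1.
    rewrite /pr -(fine_setD_null (mA 0%N) mN N0) AN fine_setD_null//.
    by rewrite probability_setT.
  have I1 : I 0%N = 1.
    have p1 : fine (P (A 0%N `\` N)) = 1 by rewrite fine_setD_null.
    rewrite /I -[RHS]mul1r -[X in _ = _ * X]p1 -Rintegral_cst;
      last exact: measurableD.
    apply: eq_Rintegral => w; rewrite inE => -[_ Nw].
    rewrite /f /u /z (goodX w Nw).1 /barrier /dot /= !subrr !mul0r addr0.
    by rewrite expr0n /= mulr0 addr0 mulr0 expR0. 
  rewrite /phi I1 pr1 mulr1 lerDl.
  by apply: mulr_ge0; [exact: ltW|exact: fine_ge0].
Qed.

(** * Choice of the constants *)

Theorem theorem1p5 (R : realType) (K r h : R) :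
  1 <= K -> 0 < r <= 1 -> 0 < h ->
  forall a b c : R, 0 < a -> 0 < b -> 0 < c ->
  exists rho lambda0 : R, [/\ 0 < rho, 1 <= lambda0 &
    forall (S : set (R * R)), infinite_set S -> S 0 ->
    forall (lambda : R) (v vp x : R * R),
      lambda0 <= lambda ->
      unit_circle v -> unit_circle vp -> dot v vp = 0 -> S x ->
    forall (d : measure_display) (Omega : measurableType d)
      (P : probability Omega R)
      (F : nat -> set (set Omega)) (X : nat -> Omega -> R * R),
      filtration F -> adapted F X ->
      (forall n w, S (X n w)) ->
      is_martingale P F X ->
      uniformly_elliptic P F X h r ->
      bounded_jumps P X K ->
      {ae P, forall w, X 0%N w = x} ->
      (rho%:E <= P (left_exit X v vp a b c lambda x))%E].
Proof.
move=> K1 /andP[r0 _] h0 a b c a0 b0 c0.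
have K0 : 0 < K by exact: lt_le_trans K1.
pose m := (c + 2 * b) / a ^+ 2.
have m0 : 0 < m.
  apply: divr_gt0; rewrite ?exprn_gt0//.
  by apply: addr_gt0 => //; exact: mulr_gt0.
(* Makes alpha r^2 h / 4 equal to 2 (m K^2 + 1), twice the loss m K^2 plus a margin of 2. *)
pose alpha := 8 * (m * K ^+ 2 + 1) / (r ^+ 2 * h).
have rh0 : 0 < r ^+ 2 * h by rewrite mulr_gt0// exprn_gt0.
have alphaE : alpha * (r ^+ 2 * h) = 8 * (m * K ^+ 2 + 1).
  by rewrite /alpha mulfVK// gt_eqF.
have al0 : 0 < alpha.
  apply: divr_gt0 => //; apply: mulr_gt0 => //; apply: addr_gt0 => //.
  by rewrite mulr_gt0// exprn_gt0.
have g0 : 0 < 1 + 2 * m * a.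
  by do ?[apply: addr_gt0 => //|apply: mulr_gt0 => //].
(* Thresholds for lambda: [l1] keeps the exponent increments within the range of the quadratic
   bound, [l2] controls the cubic remainder. In the final sum, [K] and K / b make a scaled jump at
   most 1 and at most [b]. *)
pose l1 := alpha * (1 + 2 * m * a + m) * K.
pose l2 := alpha * (1 + 2 * m * a) * m * K ^+ 3.
have l10 : 0 < l1 by do ?[apply: addr_gt0 => //|apply: mulr_gt0 => //].
have l20 : 0 < l2 by do ?[apply: exprn_gt0 => //|apply: mulr_gt0 => //].
have Kb0 : 0 < K / b by exact: divr_gt0.
pose rho := (1 - expR (- alpha * c)) / expR (alpha * (2 * b)).
exists rho, (1 + K + K / b + l1 + l2);
  split; last first.
- move=> S _ _ lambda v vp x hl uv uvp vvp _ d Omega P F X.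
  move=> hF aX _ martX ellX jX X0.
  have lam0 : 0 < lambda by lra.
  have small y z : 0 < z -> y / z <= lambda -> y / lambda <= z.
    by move=> z0; rewrite !ler_pdivrMr// mulrC.
  have mL : measurable (left_exit X v vp a b c lambda x).
    apply: measurable_left_exit => [|n]; first by rewrite mulr_ge0// ltW.
    have [Fs Fm _] := hF.
    exact: (measurable_fun_sub_sigma (Fs n) (Fm n) (aX n)).
  rewrite -[leRHS]fineK ?fin_num_measure// lee_fin /rho ler_pdivrMr ?expR_gt0//.
  rewrite [leRHS]mulrC; apply: (@left_exit_prob R K r h a b c alpha lambda
    (alpha / lambda ^+ 2) v vp x d Omega P F X) => //.
  + exact: ltW.
  + by rewrite divr_gt0// exprn_gt0.
  + by apply: small => //; rewrite divr1; lra.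
  + by apply: small => //; lra.
  + by rewrite mulrA; apply: small => //; rewrite -/m -/l1; lra.
  + rewrite -/m; set i := lambda^-1.
    have i0 : 0 < i by rewrite invr_gt0.
    have l2i : l2 * i <= 1 by apply: small => //; rewrite divr1; lra.
    rewrite -exprVn -/i.
    (* After the factor alpha / lambda^2, which is the chosen [eta], the bracket is at least m K^2 +
       2 - 1/2, hence at least 1. *)
    have -> : alpha ^+ 2 / 4 * (r * i) ^+ 2 * h - alpha * m * (K * i) ^+ 2
        - alpha ^+ 2 / 2 * (1 + 2 * m * a) * m * (K * i) ^+ 3
      = alpha * i ^+ 2 * (alpha * (r ^+ 2 * h) / 4 - m * K ^+ 2 - l2 * i / 2).
      by rewrite /l2; field.
    have mK0 : 0 < m * K ^+ 2 by rewrite mulr_gt0// exprn_gt0.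
    have ai0 : 0 < alpha * i ^+ 2 by apply: mulr_gt0; rewrite ?exprn_gt0.
    by rewrite alphaE -[leLHS]mulr1 (ler_pM2l ai0); lra.
- lra.
- rewrite /rho; apply: divr_gt0; last exact: expR_gt0.
  by rewrite subr_gt0 -expR0 ltr_expR mulNr oppr_lt0 mulr_gt0.
Qed.
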